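(* Fix $k\ge1$ and real foci $(u_1,v_1),\ldots,(u_k,v_k)$, and regard $d$ as an indeterminate (alternatively, regard all of $d,u_i,v_i$ as indeterminates). The polynomial $$p_k(x,y)=\prod_{\sigma\in\{0,1\}^k}\Bigl(d-\sum_{i=1}^k(-1)^{\sigma_i}\sqrt{(x-u_i)^2+(y-v_i)^2}\Bigr)$$ has total degree in $(x,y)$ exactly $2^k$ if $k$ is odd and exactly $2^k-\binom{k}{k/2}$ if $k$ is even. Moreover $p_k(x,y)=\det(x\cdot A_k+y\cdot B_k+C_k)$ for symmetric $2^k\times2^k$ matrices $A_k,B_k,C_k$, where $A_k,B_k$ have integer entries and the entries of $C_k$ are linear forms in $d,u_1,v_1,\ldots,u_k,v_k$.
   Context: The $k$-ellipse with foci $(u_i,v_i)$ and radius $d$ is $\{(x,y)\in\mathbb{R}^2:\sum_{i=1}^k\sqrt{(x-u_i)^2+(y-v_i)^2}=d\}$, and $p_k$ (the product above) is its defining polynomial. *)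

(* Defs.v *)
From HB Require Import structures.
From mathcomp Require Import all_boot all_order all_algebra.
From mathcomp Require Import reals.
From mathcomp Require Import mpoly.
Set Implicit Arguments. Unset Strict Implicit. Unset Printing Implicit Defensive.
Import Order.TTheory GRing.Theory Num.Theory.
Local Open Scope ring_scope.

(* Polynomials in (x, y) with coefficients in R[d]: the indeterminate d is
   the variable of {poly R}; x = 'X_0, y = 'X_1 of the bivariate mpoly ring. *)
Notation kpoly R := {mpoly {poly R}[2]}.

Definition varx (R : realType) : kpoly R := 'X_(0 : 'I_2).
Definition vary (R : realType) : kpoly R := 'X_(1 : 'I_2).

Definition kellipse_prod (R : realType) (k : nat) (u v : 'I_k -> R)
    (x y d : R) : R :=
  \prod_(s : {ffun 'I_k -> bool})
     (d - \sum_(i < k) (-1) ^+ (s i) * Num.sqrt ((x - u i) ^+ 2 + (y - v i) ^+ 2)).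

Definition is_kellipse_poly (R : realType) (k : nat) (u v : 'I_k -> R)
    (P : kpoly R) : Prop :=
  forall x y d : R,
    (P.@[fun i : 'I_2 => if i == 0 then x%:P else y%:P]).[d]
    = kellipse_prod u v x y d.

Definition symmx (T : Type) (n : nat) (M : 'M[T]_n) : Prop := M^T = M.

Definition pencil (R : realType) (k : nat) (A B : 'M[int]_(2 ^ k))
    (Cd : 'M[R]_(2 ^ k)) (Cu Cv : 'I_k -> 'M[R]_(2 ^ k))
    (u v : 'I_k -> R) : 'M[kpoly R]_(2 ^ k) :=
  \matrix_(i, j)
    (varx R * (A i j)%:~R + vary R * (B i j)%:~R
     + ((Cd i j) *: 'X + (\sum_(l < k) (u l * Cu l i j + v l * Cv l i j))%:P)%:MP).

Definition kdeg (k : nat) : nat :=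
  if odd k then (2 ^ k)%N else (2 ^ k - 'C(k, k./2))%N.

(* Main.v *)
Require Import Defs.
From HB Require Import structures.
From mathcomp Require Import all_boot all_order all_algebra.
From mathcomp Require Import reals.
From mathcomp Require Import mpoly.
From mathcomp Require Import boolp ring lra.
Set Implicit Arguments. Unset Strict Implicit. Unset Printing Implicit Defensive.
Import Order.TTheory GRing.Theory Num.Theory.
Local Open Scope ring_scope.

(** Degree: along a ray (ta, tb) every distance is t * sqrt(a^2 + b^2) + O(1),
    so the factor of a sign vector s grows linearly in t unless the signs of s
    are balanced, in which case it stays bounded; for d larger than the total
    l^1-norm of the foci it also stays away from 0.  Hence the restriction of
    p_k to a ray has degree at most the number of unbalanced sign vectors, with
    equality for d large and (a, b) = (1, 0), while a suitable ray and a
    suitable d retain the total degree.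

    Determinant: [[x - u_l, y - v_l], [y - v_l, -(x - u_l)]] has eigenvalues
    +-r_l, where r_l is the distance to the l-th focus, so the tensor sum of
    these k matrices, acting on a space with basis {0,1}^k, has the eigenvalues
    \sum_l +-r_l; tensor products of the 2x2 eigenvectors diagonalise it. *)

(** * Bounding the degree of a univariate polynomial by its growth *)

Section PolyGrowth.
Variable R : realFieldType.
Implicit Types (q : {poly R}) (n : nat) (c C K T : R).

(** [K] is the sum of the absolute values of the coefficients. The factor [t] on the left expresses
    growth of order [n - 1] without a truncated predecessor at [n = 0]. *)
Lemma horner_growth q n : (size q <= n)%N ->
  exists2 K, 0 <= K & forall t, 1 <= t -> t * `|q.[t]| <= K * t ^+ n.
Proof.
move=> hq; exists (\sum_(i < size q) `|q`_i|) => [|t ht].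
  by apply: sumr_ge0 => i _; exact: normr_ge0.
have t0 : 0 <= t by exact: le_trans ht.
rewrite horner_coef mulr_suml.
apply: (le_trans (ler_wpM2l t0 (ler_norm_sum _ _ _))).
rewrite mulr_sumr; apply: ler_sum => i _.
rewrite normrM normrX (ger0_norm t0) mulrCA -exprS ler_wpM2l //.
by apply: ler_weXn2l => //; apply: leq_trans hq.
Qed.

Lemma growth_lt_size q n c T : 0 < c ->
  (forall t, T <= t -> c * t ^+ n <= `|q.[t]|) -> (n < size q)%N.
Proof.
move=> c0 hc; rewrite ltnNge; apply/negP => /horner_growth[K K0 hK].
(* Beyond [T] and beyond [K / c]: the two bounds would force [t * c <= K]. *)
pose t := Num.max T 0 + 1 + K / c.
have M0 : 0 <= Num.max T 0 by rewrite le_max lexx orbT.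
have MT : T <= Num.max T 0 by rewrite le_max lexx.
have Kc : 0 <= K / c by rewrite divr_ge0 // ltW.
have t1 : 1 <= t by rewrite /t; lra.
have tT : T <= t by rewrite /t; lra.
have t0 : 0 < t by lra.
have h1 : t * (c * t ^+ n) <= K * t ^+ n.
  by apply: le_trans (hK t t1); rewrite ler_pM2l // hc.
have tn : 0 < t ^+ n by rewrite exprn_gt0.
move: h1; rewrite mulrA ler_pM2r //.
have -> : t * c = (Num.max T 0 + 1) * c + K.
  by rewrite /t mulrDl divfK ?gt_eqF.
by have : 0 < (Num.max T 0 + 1) * c; [rewrite mulr_gt0 //; lra | lra].
Qed.

Lemma growth_size_le q n C :
  (forall t, 1 <= t -> `|q.[t]| <= C * t ^+ n) -> (size q <= n.+1)%N.
Proof.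
move=> hC; rewrite leqNgt; apply/negP => hn.
have q0 : q != 0 by rewrite -size_poly_gt0; apply: leq_trans hn.
pose m := (size q).-1.
have hm : size q = m.+1 by rewrite prednK // size_poly_gt0.
have nm : (n < m)%N by rewrite -ltnS -hm.
(* If the degree [m] exceeded [n], the leading term would be bounded by [q] and this remainder, both
   of order at most [m - 1]. *)
pose p := q - lead_coef q *: 'X^m.
have hp : (size p <= m)%N.
  apply/leq_sizeP => j; rewrite leq_eqVlt => /predU1P[<-|mj].
    by rewrite coefB coefZ coefXn eqxx mulr1 subrr.
  rewrite coefB coefZ coefXn gtn_eqF // mulr0 subr0.
  by apply: nth_default; rewrite hm.
have [K K0 hK] := horner_growth hp.
have lc0 : 0 < `|lead_coef q| by rewrite normr_gt0 lead_coef_eq0.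
have C0 : 0 <= C by have := hC 1 (lexx _); rewrite expr1n mulr1; apply: le_trans.
pose t := 1 + (C + K) / `|lead_coef q|.
have CK0 : 0 <= (C + K) / `|lead_coef q|.
  by rewrite divr_ge0 ?addr_ge0 // ltW.
have t1 : 1 <= t by rewrite /t; lra.
have t0 : 0 < t by lra.
have eqlc : `|lead_coef q| * t ^+ m <= `|q.[t]| + `|p.[t]|.
  have -> : `|lead_coef q| * t ^+ m = `|q.[t] - p.[t]|.
    rewrite /p hornerD hornerN hornerZ hornerXn opprB addrC subrK.
    by rewrite normrM normrX (ger0_norm (ltW t0)).
  exact: ler_normB.
have h : t * (`|lead_coef q| * t ^+ m) <= (C + K) * t ^+ m.
  apply: (le_trans (ler_wpM2l (ltW t0) eqlc)); rewrite mulrDr [leRHS]mulrDl lerD ?hK //.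
  apply: (@le_trans _ _ (C * t ^+ n.+1)); last first.
    by rewrite ler_wpM2l // ler_weXn2l.
  by rewrite exprS mulrCA ler_pM2l // hC.
move: h; rewrite mulrA ler_pM2r ?exprn_gt0 //.
have -> : t * `|lead_coef q| = `|lead_coef q| + (C + K).
  by rewrite /t mulrDl mul1r divfK ?gt_eqF.
by lra.
Qed.

End PolyGrowth.

(** * Restriction of a bivariate polynomial to a line through the origin *)

Section Restriction.
Variable R : realType.
Implicit Types P : kpoly R.

Definition ray_poly P (a b d : R) : {poly R} :=
  \sum_(m <- msupp P) (P@_m).[d] * a ^+ m 0 * b ^+ m 1 *: 'X^(mdeg m).

Lemma horner_ray_poly P a b d t :
  (ray_poly P a b d).[t] =
  (P.@[fun i : 'I_2 => if i == 0 then (t * a)%:P else (t * b)%:P]).[d].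
Proof.
rewrite /ray_poly mevalE !horner_sum; apply: eq_bigr => m _.
rewrite hornerZ hornerXn hornerM big_ord_recl big_ord1 /=.
have -> : lift ord0 ord0 = 1 :> 'I_2 by exact: val_inj.
rewrite (_ : ord0 = 0 :> 'I_2) // -!polyC_exp hornerM !hornerC !exprMn.
have -> : mdeg m = (m 0%R + m 1%R)%N.
  rewrite mdegE big_ord_recl big_ord1; congr (m _ + m _)%N; exact: val_inj.
by rewrite exprD; ring.
Qed.

Lemma size_ray_poly P a b d : (size (ray_poly P a b d) <= msize P)%N.
Proof.
apply/leq_sizeP => j hj; rewrite coef_sum big_seq big1 // => m hm.
rewrite coefZ coefXn gtn_eqF ?mulr0 //.
by apply: leq_trans hj; exact: msize_mdeg_lt.
Qed.

(** The [size p] distinct points 0, 1, 2, ... are one more than the degree, so they cannot all be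
    roots. *)
Lemma poly_neq0_nonroot (p : {poly R}) : p != 0 -> exists x, p.[x] != 0.
Proof.
move=> p0; pose s : seq R := [seq i%:R | i <- iota 0 (size p)].
have us : uniq s.
  by rewrite map_inj_uniq ?iota_uniq // => i j /eqP; rewrite eqr_nat => /eqP.
case: (boolP (all (root p) s)) => [hs|/allPn[x _ hx]]; last by exists x.
by have := max_poly_roots p0 hs us; rewrite size_map size_iota ltnn.
Qed.

Lemma ray_poly_full_size P : P != 0 ->
  exists a d, size (ray_poly P a 1 d) = msize P.
Proof.
move=> P0; pose m0 := mlead P.
have hm0 : m0 \in msupp P := mlead_supp P0.
have [d hd] : exists d, (P@_m0).[d] != 0.
  by apply: poly_neq0_nonroot; rewrite -mcoeff_msupp.
(* The top-degree form of [P] at this [d], dehomogenised by setting y = 1. Its value at [a] is the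
   top coefficient of the restriction in direction [(a, 1)]. *)
pose g : {poly R} := \sum_(m <- msupp P | mdeg m == mdeg m0)
   (P@_m).[d] *: 'X^(m 0).
have g0 : g != 0.
  apply: contraNneq hd => g0; have : g`_(m0 0) = 0 by rewrite g0 coef0.
  rewrite coef_sum big_mkcond (bigD1_seq m0) ?msupp_uniq //= eqxx.
  rewrite coefZ coefXn eqxx mulr1 big1 ?addr0 => [->//|m hne].
  case: eqP => // hm.
  rewrite coefZ coefXn; case: eqP => [e|]; last by rewrite mulr0.
  (* In two variables, the total degree and the exponent of x determine a monomial, so no other term
     of [g] can cancel that of [m0]. *)
  case/eqP: hne; apply/mnmP => i.
  have e0 : m 0 = m0 0 by [].
  move: hm; rewrite !mdegE !big_ord_recl !big_ord0 (_ : ord0 = 0 :> 'I_2) // e0.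
  move=> /addnI/addIn e1.
  case: i => [[|[|//]] hi].
    by rewrite (_ : Ordinal hi = 0) //; apply: val_inj.
  by rewrite (_ : Ordinal hi = lift 0 0) //; apply: val_inj.
have [a ha] := poly_neq0_nonroot g0.
exists a, d; apply/eqP; rewrite eqn_leq size_ray_poly /= -(mlead_deg P0).
rewrite ltnNge; apply/negP => /leq_sizeP/(_ _ (leqnn _)) h.
case/eqP: ha; rewrite -[RHS]h coef_sum horner_sum.
rewrite [LHS]big_mkcond; apply: eq_bigr => m _.
rewrite coefZ coefXn expr1n mulr1 eq_sym; case: eqP => _; last by rewrite mulr0.
by rewrite hornerZ hornerXn mulr1.
Qed.

End Restriction.

(** * Counting balanced sign vectors *)

Section Count.
Variable k : nat.
Implicit Type s : {ffun 'I_k -> bool}.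

Definition signsum (R : pzRingType) s : R := \sum_(i < k) (-1) ^+ s i.

Lemma signsum_card (R : pzRingType) s :
  signsum R s = k%:R - (#|[set i | s i]| * 2)%:R.
Proof.
have -> : signsum R s = \sum_(i < k) (1 - (s i * 2)%:R).
  apply: eq_bigr => i _; case: (s i); last by rewrite subr0.
  by rewrite mul1n (natrD _ 1 1) opprD addrA subrr add0r.
rewrite sumrB sumr_const card_ord -natr_sum; congr (_ - _%:R).
rewrite -big_distrl -sum1_card [in RHS]big_mkcond; congr (_ * _)%N.
by apply: eq_bigr => i _; rewrite inE; case: (s i).
Qed.

Lemma signsum_eq0 (R : numDomainType) s :
  (signsum R s == 0) = (#|[set i | s i]| * 2 == k)%N.
Proof. by rewrite signsum_card subr_eq0 eqr_nat eq_sym. Qed.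

(** A sign vector is determined by its set of minus signs, and it is balanced when this set contains
    exactly half of the indices. *)
Lemma card_signsum_eq0 (R : numDomainType) :
  #|[set s | signsum R s == 0]| = if odd k then 0%N else 'C(k, k./2).
Proof.
transitivity #|[set A : {set 'I_k} | #|A| * 2 == k]%N|.
  rewrite -(card_imset _ (f := fun s => [set i | s i])).
    congr #|pred_of_set _|; apply/setP => A; rewrite inE.
    apply/imsetP/idP.
      by case=> s; rewrite inE signsum_eq0 => ? ->.
    move=> hA; exists [ffun i => i \in A].
      rewrite inE signsum_eq0 (_ : [set _ | _] = A) //.
      by apply/setP => i; rewrite inE ffunE.
    by apply/setP => i; rewrite inE ffunE.
  move=> s1 s2 /setP h; apply/ffunP => i; by have := h i; rewrite !inE.
case: ifP => ok.
  apply: eq_card0 => A; rewrite inE; apply/negbTE; apply: contraTneq ok => <-.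
  by rewrite muln2 odd_double.
rewrite -[k in 'C(k, _)]card_ord -card_draws; apply: eq_card => A; rewrite !inE.
have kE : (k./2.*2)%N = k by rewrite -[RHS]odd_double_half ok.
by rewrite muln2 -[RHS](inj_eq double_inj) kE.
Qed.

(** In this form [t ^+ kdeg k] splits over the factors of the product: one power of [t] for each
    unbalanced factor, none for a balanced one. *)
Lemma sum_signsum_neq0 (R : numDomainType) :
  (\sum_(s : {ffun 'I_k -> bool}) (signsum R s != 0%R : nat) = kdeg k)%N.
Proof.
have := cardsC [set s | signsum R s == 0].
rewrite card_signsum_eq0 card_ffun card_bool card_ord /kdeg => h.
transitivity #|~: [set s | signsum R s == 0]|.
  rewrite -sum1_card [RHS]big_mkcond; apply: eq_bigr => s _.
  by rewrite !inE; case: eqP.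
by move: h; case: ifP => _ <-; rewrite ?add0n // addKn.
Qed.

End Count.

(** * Growth of the product along rays *)

Lemma sqrt_lipschitz (R : rcfType) (p q u v : R) :
  `|Num.sqrt ((p - u) ^+ 2 + (q - v) ^+ 2) - Num.sqrt (p ^+ 2 + q ^+ 2)|
    <= `|u| + `|v|.
Proof.
(* The one-sided bound gives both sides: shift [(p, q)] by [(-u, -v)], or shift [(p - u, q - v)]
   back by [(u, v)]. *)
have half (a b c d : R) :
    Num.sqrt ((a + c) ^+ 2 + (b + d) ^+ 2)
      <= Num.sqrt (a ^+ 2 + b ^+ 2) + (`|c| + `|d|).
  have nn (x y : R) : 0 <= x ^+ 2 + y ^+ 2 by rewrite addr_ge0 ?sqr_ge0.
  set s := Num.sqrt (a ^+ 2 + b ^+ 2).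
  have s0 : 0 <= s by exact: sqrtr_ge0.
  have sE : s ^+ 2 = a ^+ 2 + b ^+ 2 by rewrite sqr_sqrtr.
  have la : `|a| <= s by rewrite -sqrtr_sqr ler_wsqrtr // lerDl sqr_ge0.
  have lb : `|b| <= s by rewrite -sqrtr_sqr ler_wsqrtr // lerDr sqr_ge0.
  have r0 : 0 <= s + (`|c| + `|d|) by rewrite !addr_ge0.
  rewrite -[leRHS](ger0_norm r0) -[leRHS]sqrtr_sqr ler_wsqrtr //.
  have ac : a * c <= s * `|c|.
    by apply: le_trans (ler_norm _) _; rewrite normrM ler_wpM2r.
  have bd : b * d <= s * `|d|.
    by apply: le_trans (ler_norm _) _; rewrite normrM ler_wpM2r.
  have cd : 0 <= `|c| * `|d| by rewrite mulr_ge0.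
  have c2 : `|c| ^+ 2 = c ^+ 2 by rewrite real_normK ?num_real.
  have d2 : `|d| ^+ 2 = d ^+ 2 by rewrite real_normK ?num_real.
  have -> : (s + (`|c| + `|d|)) ^+ 2 = s ^+ 2 + `|c| ^+ 2 + `|d| ^+ 2 +
    2 * (s * `|c|) + 2 * (s * `|d|) + 2 * (`|c| * `|d|) by ring.
  by rewrite sE c2 d2; nra.
rewrite ler_norml; apply/andP; split; last first.
  by have := half p q (- u) (- v); rewrite !normrN => ?; lra.
by have := half (p - u) (q - v) u v; rewrite !subrK => ?; lra.
Qed.

Section Growth.
Variables (R : realType) (k : nat) (u v : 'I_k -> R).
Implicit Type s : {ffun 'I_k -> bool}.

Definition kfactor (x y d : R) s : R :=
  d - \sum_(i < k) (-1) ^+ s i * Num.sqrt ((x - u i) ^+ 2 + (y - v i) ^+ 2).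

Let W := \sum_(i < k) (`|u i| + `|v i|).

Lemma kfactor_approx (a b d t : R) s : 0 <= t ->
  `|kfactor (t * a) (t * b) d s
     - (d - signsum R s * (t * Num.sqrt (a ^+ 2 + b ^+ 2)))| <= W.
Proof.
move=> t0; have -> : t * Num.sqrt (a ^+ 2 + b ^+ 2)
    = Num.sqrt ((t * a) ^+ 2 + (t * b) ^+ 2).
  by rewrite !exprMn -mulrDr sqrtrM ?sqr_ge0 // sqrtr_sqr ger0_norm.
rewrite /kfactor /signsum mulr_suml opprB addrC addrA subrK.
rewrite -sumrB (le_trans (ler_norm_sum _ _ _)) // ler_sum //.
move=> i _; rewrite -mulrBr normrM normrX normrN normr1 expr1n mul1r distrC.
exact: sqrt_lipschitz.
Qed.

Lemma kellipse_prod_upper (a b d : R) : exists C, forall t, 1 <= t ->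
  `|kellipse_prod u v (t * a) (t * b) d| <= C * t ^+ kdeg k.
Proof.
pose rho := Num.sqrt (a ^+ 2 + b ^+ 2).
have rho0 : 0 <= rho by exact: sqrtr_ge0.
(* A balanced factor is at most [|d| + W]; an unbalanced one gains slope [|signsum R s| * rho], and
   [1 <= t] absorbs its constant part. *)
exists (\prod_(s : {ffun 'I_k -> bool}) (`|d| + W + `|signsum R s| * rho)) => t t1.
have t0 : 0 <= t by lra.
rewrite -(sum_signsum_neq0 k R) -prodrXr -big_split /= normr_prod.
apply: ler_prod => s _; rewrite normr_ge0 /=.
have := kfactor_approx a b d s t0; rewrite -/rho -/(kfactor _ _ _ _).
set f := kfactor _ _ _ _ => hf.
have W0 : 0 <= W by apply: le_trans hf.
have h1 : `|f| <= W + `|d - signsum R s * (t * rho)|.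
  rewrite -[X in `|X| <= _](subrK (d - signsum R s * (t * rho))).
  by apply: le_trans (ler_normD _ _) _; rewrite lerD2r.
case: eqP hf h1 => [->|_] hf h1 /=.
  by move: h1; rewrite normr0 !mul0r subr0 addr0 expr0 mulr1 addrC.
have h2 : `|d - signsum R s * (t * rho)| <= `|d| + `|signsum R s| * (t * rho).
  apply: le_trans (ler_normB _ _) _.
  by rewrite lerD2l normrM (ger0_norm (mulr_ge0 t0 rho0)).
have d0 := normr_ge0 d.
rewrite expr1; set e := `|signsum R s| in h2 *.
have : (`|d| + W) * 1 <= (`|d| + W) * t by rewrite ler_wpM2l // addr_ge0.
by move=> h3; rewrite mulrDl -mulrA (mulrC rho); lra.
Qed.

Lemma kellipse_prod_lower : exists d c T, 0 < c /\ forall t, T <= t ->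
  c * t ^+ kdeg k <= `|kellipse_prod u v (t * 1) (t * 0) d|.
Proof.
have W0 : 0 <= W by apply: sumr_ge0 => i _; rewrite addr_ge0.
(* With [d = W + 1] balanced factors are at least 1. Unbalanced ones are at least [t - (2 * W + 1)]
   in absolute value, hence at least [t / 2] past the threshold. *)
exists (W + 1), (\prod_(s : {ffun 'I_k -> bool}) (2^-1)), (2 * (2 * W + 1)); split.
  by apply: prodr_gt0 => s _; rewrite invr_gt0.
move=> t tT; have t0 : 0 <= t by lra.
rewrite -(sum_signsum_neq0 k R) -prodrXr -big_split /= normr_prod.
apply: ler_prod => s _; apply/andP; split.
  by rewrite mulr_ge0 ?exprn_ge0 ?invr_ge0.
have := kfactor_approx 1 0 (W + 1) s t0; rewrite -/(kfactor _ _ _ _).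
set f := kfactor _ _ _ _.
rewrite expr0n /= addr0 sqrtr_sqr normr1 mulr1.
have [->|e0] := eqVneq (signsum R s) 0.
  rewrite mul0r subr0 expr0 mulr1 ler_distl => /andP[h _].
  by apply: le_trans (ler_norm _); lra.
(* A nonzero integer has absolute value at least 1. *)
have e1 : 1 <= `|signsum R s|.
  apply: norm_intr_ge1 => //; apply: rpred_sum => i _.
  by apply: rpredX; rewrite rpredN rpred1.
set e := signsum R s in e0 e1 *; rewrite expr1 => hf.
have h1 : `|e| * t <= `|f| + (2 * W + 1).
  rewrite -{1}(ger0_norm t0) -normrM.
  have -> : e * t = f - (W + 1 - e * t) - f + (W + 1) by ring.
  apply: le_trans (ler_normD _ _) _; rewrite [X in _ + X]ger0_norm; last lra.
  by have := ler_normB (f - (W + 1 - e * t)) f; lra.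
have h2 : 1 * t <= `|e| * t by rewrite ler_wpM2r.
by lra.
Qed.

End Growth.

(** * Determinants from eigenbases indexed by a finite type *)

Section Transport.
Variables (F : fieldType) (T : finType) (n : nat) (cardT : #|T| = n).

Definition idx (i : 'I_n) : T := enum_val (cast_ord (esym cardT) i).

Lemma idx_bij : bijective idx.
Proof.
exists (fun f => cast_ord cardT (enum_rank f)) => x; rewrite /idx.
  by rewrite enum_valK cast_ordKV.
by rewrite cast_ordK enum_rankK.
Qed.

(** The columns of [S] are eigenvectors, so MS = SD with D diagonal; [S'] makes the determinant of
    [S] nonzero, and it cancels. *)
Lemma det_of_eigenbasis (M S S' : T -> T -> F) (lam : T -> F) :
  (forall f h, \sum_g S f g * S' g h = (f == h)%:R) ->
  (forall f h, \sum_g M f g * S g h = lam h * S f h) ->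
  \det (\matrix_(i < n, j < n) M (idx i) (idx j)) = \prod_f lam f.
Proof.
move=> hS hM.
pose mx (G : T -> T -> F) := \matrix_(i < n, j < n) G (idx i) (idx j).
have mxM (G H : T -> T -> F) :
    mx G *m mx H = mx (fun f h => \sum_g G f g * H g h).
  apply/matrixP => i j; rewrite !mxE (reindex idx) /=; last exact: onW_bij idx_bij.
  by apply: eq_bigr => l _; rewrite !mxE.
have S1 : mx S *m mx S' = 1%:M.
  rewrite mxM; apply/matrixP => i j; rewrite !mxE hS.
  by rewrite (inj_eq (bij_inj idx_bij)).
have SD : mx M *m mx S = mx S *m diag_mx (\row_j lam (idx j)).
  rewrite mxM; apply/matrixP => i j.
  by rewrite mul_mx_diag !mxE hM mulrC.
have dS : \det (mx S) != 0.
  have := det1 F n; rewrite -S1 det_mulmx; apply: contra_eq_neq => ->.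
  by rewrite mul0r eq_sym oner_eq0.
apply: (mulIf dS); rewrite -det_mulmx SD det_mulmx det_diag mulrC; congr (_ * _).
rewrite [RHS](reindex idx) /=; last exact: onW_bij idx_bij.
by apply: eq_bigr => i _; rewrite mxE.
Qed.

End Transport.

(** * Kronecker products and Kronecker sums *)

Section TensorSum.
Variables (F : fieldType) (I J : finType).
Implicit Types f g h : {ffun I -> J}.

Definition agree_off (l : I) f g := [forall i, (i != l) ==> (f i == g i)].

Lemma agree_offC l f g : agree_off l f g = agree_off l g f.
Proof. by apply: eq_forallb => i; rewrite [f i == _]eq_sym. Qed.

Definition tensor (S : I -> J -> J -> F) f g : F := \prod_i S i (f i) (g i).

(** The Kronecker sum: [M l] acts on slot [l], and [agree_off] is the identity on all other
    slots. *)
Definition tensor_sum (M : I -> J -> J -> F) f g : F :=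
  \sum_l (agree_off l f g)%:R * M l (f l) (g l).

Lemma tensor_mul S S' f h :
  \sum_g tensor S f g * tensor S' g h =
  \prod_i \sum_b S i (f i) b * S' i b (h i).
Proof.
rewrite bigA_distr_bigA; apply: eq_bigr => g _.
by rewrite -big_split.
Qed.

Lemma tensor_delta f h : \prod_i (f i == h i)%:R = (f == h)%:R :> F.
Proof.
case: eqP => [->|fh]; first by rewrite big1 // => i _; rewrite eqxx.
have [i hi] : exists i, f i != h i.
  apply/existsP; apply: contra_notT fh; rewrite negb_exists => /forallP fh.
  by apply/ffunP => i; apply/eqP; have := fh i; rewrite negbK.
by rewrite (bigD1 i) //= (negbTE hi) mul0r.
Qed.

Lemma tensor_summand M l f g :
  (agree_off l f g)%:R * M (f l) (g l) =
  tensor (fun i a b => if i == l then M a b else (a == b)%:R) f g.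
Proof.
rewrite /tensor (bigD1 l) //= eqxx mulrC; congr (_ * _).
under eq_bigr => i hi do rewrite (negbTE hi).
case: (boolP (agree_off l f g)) => [/forallP fg|].
  by rewrite big1 // => i hi; have := fg i; rewrite hi => /= ->.
rewrite negb_forall => /existsP[i]; rewrite negb_imply => /andP[hi fg].
by rewrite (bigD1 i) //= (negbTE fg) mul0r.
Qed.

(** Each summand is itself a Kronecker product, so it multiplies with [tensor S] slot by slot: slot
    [l] yields [lam l (h l)], the others are unchanged. *)
Lemma tensor_sum_eigen M S lam f h :
  (forall l a c, \sum_b M l a b * S l b c = lam l c * S l a c) ->
  \sum_g tensor_sum M f g * tensor S g h = (\sum_l lam l (h l)) * tensor S f h.
Proof.
move=> hM; rewrite mulr_suml; under eq_bigr => g _ do rewrite mulr_suml.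
rewrite exchange_big; apply: eq_bigr => l _ /=.
under eq_bigr => g _ do rewrite tensor_summand.
rewrite tensor_mul /tensor (bigD1 l) //= [in RHS](bigD1 l) //= mulrA eqxx hM.
congr (_ * _); apply: eq_bigr => i hi; rewrite (negbTE hi).
rewrite (bigD1 (f i)) //= eqxx mul1r big1 ?addr0 // => b hb.
by rewrite eq_sym (negbTE hb) mul0r.
Qed.

End TensorSum.

(** * Diagonalisation of the 2x2 blocks *)

Section TwoByTwo.
Variable R : realFieldType.

Definition zmat (a b : bool) : int := if a == b then (-1) ^+ a else 0.
Definition xmat (a b : bool) : int := (a != b).

Definition refl2 (p q : R) (a b : bool) : R :=
  p * (zmat a b)%:~R + q * (xmat a b)%:~R.

Lemma refl2_diag (p q r : R) : r ^+ 2 = p ^+ 2 + q ^+ 2 ->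
  exists S S' : bool -> bool -> R,
    (forall a c, \sum_b S a b * S' b c = (a == c)%:R) /\
    (forall a c, \sum_b refl2 p q a b * S b c = (-1) ^+ c * r * S a c).
Proof.
move=> hr; have [pr|pr] := eqVneq (p + r) 0.
  have q0 : q = 0 by apply/eqP; rewrite -sqrf_eq0; apply/eqP; nra.
  have pE : p = - r by lra.
  (* The generic eigenvector (p + r, q) vanishes here, and refl2 is diagonal. *)
  exists (fun a b => (a != b)%:R), (fun a b => (a != b)%:R).
  by split=> [] [] []; rewrite big_bool /refl2 /zmat /xmat /= ?q0 ?pE; ring.
pose N := (p + r) ^+ 2 + q ^+ 2.
have N0 : N != 0.
  rewrite gt_eqF // ltr_wpDr ?sqr_ge0 // lt_def sqr_ge0 andbT.
  by rewrite sqrf_eq0.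
(* The columns [(p + r, q)] and [(-q, p + r)] are orthogonal eigenvectors for [r] and [-r], both of
   squared length [N]; the inverse is the transpose over [N]. *)
exists (fun a b => if a == b then p + r else (if a then q else - q)).
exists (fun a b => (if a == b then p + r else (if a then - q else q)) / N).
split=> [] [] []; rewrite big_bool /refl2 /zmat /xmat /=.
- by apply: (mulIf N0); rewrite mulrDl -!mulrA mulVf // /N; ring.
- by ring.
- by ring.
- by apply: (mulIf N0); rewrite mulrDl -!mulrA mulVf // /N; ring.
all: by ring: hr.
Qed.

End TwoByTwo.

(** * The determinantal representation *)

Lemma horner_meval_det (R : comNzRingType) (m n : nat) (w : 'I_m -> {poly R})
    (d : R) (M : 'M[{mpoly {poly R}[m]}]_n) :
  ((\det M).@[w]).[d] = \det (\matrix_(i, j) ((M i j).@[w]).[d]).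
Proof.
rewrite -[LHS]/(horner_eval d (meval w (\det M))) -!det_map_mx.
by congr determinant; apply/matrixP => i j; rewrite !mxE.
Qed.

Section Determinant.
Variables (R : realType) (k : nat).

Let card_signs : #|{ffun 'I_k -> bool}| = (2 ^ k)%N.
Proof. by rewrite card_ffun card_bool card_ord. Qed.

Let e := idx card_signs.

(** The matrix [Z] in slot [l] and the identity elsewhere. The ring is a parameter because it serves
    over the integers for x and y and over the reals for the foci. *)
Definition coef_mx (T : pzRingType) (l : 'I_k) (Z : bool -> bool -> int) :
    'M[T]_(2 ^ k) :=
  \matrix_(i, j) ((agree_off l (e i) (e j))%:R * (Z (e i l) (e j l))%:~R).

Lemma coef_mx_sym (T : pzRingType) l Z : (forall a b, Z a b = Z b a) ->
  symmx (coef_mx T l Z).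
Proof.
move=> hZ; apply/matrixP => i j; by rewrite !mxE hZ agree_offC.
Qed.

Lemma xmat_sym a b : xmat a b = xmat b a.
Proof. by case: a b => [] []. Qed.

Lemma zmat_sym a b : zmat a b = zmat b a.
Proof. by case: a b => [] []. Qed.

Lemma pencil_kellipse (u v : 'I_k -> R) :
  is_kellipse_poly u v (\det (pencil (- \sum_l coef_mx int l zmat)
    (- \sum_l coef_mx int l xmat) 1%:M
    (fun l => coef_mx R l zmat) (fun l => coef_mx R l xmat) u v)).
Proof.
move=> x y d; rewrite horner_meval_det.
pose p l := x - u l; pose q l := y - v l.
pose r l := Num.sqrt (p l ^+ 2 + q l ^+ 2).
have hr l : r l ^+ 2 = p l ^+ 2 + q l ^+ 2.
  by rewrite sqr_sqrtr // addr_ge0 ?sqr_ge0.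
have [S /boolp.choice[S' hS]] := boolp.choice (fun l => refl2_diag (hr l)).
(* Expanding [-(x - u l)] and [-(y - v l)] explains the signs in the pencil: minus on x and y, plus
   on the foci. *)
pose M f g : R := (f == g)%:R * d - tensor_sum (fun l => refl2 (p l) (q l)) f g.
transitivity (\det (\matrix_(i < 2 ^ k, j < 2 ^ k) M (e i) (e j))).
  congr determinant; apply/matrixP => i j; rewrite !mxE.
  have intE (c : int) :
      (c%:~R.@[fun i : 'I_2 => if i == 0 then x%:P else y%:P]).[d] = c%:~R.
    by rewrite -[LHS]/(horner_eval d (meval _ _)) !rmorph_int.
  have coefE Z : (- (\sum_l coef_mx int l Z) i j)%:~R =
      - \sum_l coef_mx R l Z i j :> R.
    rewrite summxE rmorphN rmorph_sum; congr (- _); apply: eq_bigr => l _.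
    by rewrite !mxE intz rmorphM rmorph_nat.
  rewrite !mevalD !mevalM mevalC /varx /vary !mevalXU /=.
  rewrite !hornerD !hornerM hornerZ hornerX !hornerC !intE !coefE.
  rewrite /M (inj_eq (bij_inj (idx_bij card_signs))) /tensor_sum.
  rewrite !mulrN !mulr_sumr addrCA -!sumrN -!big_split /=.
  congr (_ + _); apply: eq_bigr => l _; rewrite !mxE /refl2 /p /q; ring.
have hSS f h : \sum_g tensor S f g * tensor S' g h = (f == h)%:R.
  rewrite tensor_mul -tensor_delta; apply: eq_bigr => l _.
  by case: (hS l).
rewrite (det_of_eigenbasis card_signs
  (lam := fun f => d - \sum_l (-1) ^+ f l * r l) hSS) // => f h.
under eq_bigr do rewrite mulrBl.
rewrite sumrB (tensor_sum_eigen (lam := fun l (c : bool) => (-1) ^+ c * r l)).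
  rewrite (bigD1 f) //= eqxx mul1r big1 ?addr0 ?mulrBl // => g hg.
  by rewrite eq_sym (negbTE hg) !mul0r.
by move=> l; case: (hS l).
Qed.

End Determinant.

(** * Assembly of the degree formula and the determinant *)

Theorem theorem1 (R : realType) (k : nat) (hk : (1 <= k)%N) :
  (forall (u v : 'I_k -> R) (P : kpoly R),
      is_kellipse_poly u v P -> msize P = (kdeg k).+1)
  /\
  (exists (A B : 'M[int]_(2 ^ k)) (Cd : 'M[R]_(2 ^ k)) (Cu Cv : 'I_k -> 'M[R]_(2 ^ k)),
      [/\ symmx A, symmx B, symmx Cd,
          (forall l, symmx (Cu l) /\ symmx (Cv l)) &
          forall u v : 'I_k -> R, is_kellipse_poly u v (\det (pencil A B Cd Cu Cv u v))]).
Proof.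
split=> [u v P hP|].
  have rayE a b d t : (ray_poly P a b d).[t] = kellipse_prod u v (t * a) (t * b) d.
    by rewrite horner_ray_poly hP.
  have lower : (kdeg k < msize P)%N.
    have [d [c [T [c0 hc]]]] := kellipse_prod_lower u v.
    apply: leq_trans (size_ray_poly P 1 0 d).
    by apply: (growth_lt_size (T := T) c0) => t tT; rewrite rayE hc.
  apply/eqP; rewrite eqn_leq lower andbT.
  (* The lower bound comes first because choosing a degree-preserving ray requires a nonzero [P]. *)
  have P0 : P != 0 by rewrite -msize_poly_eq0 -lt0n (leq_ltn_trans _ lower).
  have [a [d <-]] := ray_poly_full_size P0.
  have [C hC] := kellipse_prod_upper u v a 1 d.
  by apply: (growth_size_le (C := C)) => t t1; rewrite rayE hC.
have symN (M : 'M[int]_(2 ^ k)) : symmx M -> symmx (- M).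
  by move=> hM; rewrite /symmx linearN /= hM.
have symS Z : (forall a b, Z a b = Z b a) ->
    symmx (\sum_l coef_mx int l Z).
  by move=> hZ; rewrite /symmx linear_sum; apply: eq_bigr => l _; exact: coef_mx_sym.
do 5 eexists; split; last exact: pencil_kellipse.
- exact/symN/symS/zmat_sym.
- exact/symN/symS/xmat_sym.
- exact: tr_scalar_mx.
- by move=> l; split; apply: coef_mx_sym; [exact: zmat_sym | exact: xmat_sym].
Qed.
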